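(* Let $r,p,s,n$ be positive integers such that $p\mid r$, $s\mid r$ and $ps\mid rn$. Let $\epsilon\in\{1,-1\}$ and $k\in\{0,1,\ldots,\frac{r}{p}-1\}$ with $s\mid kn$, let $\zeta=\zeta_r=e^{2\pi i/r}$, and let $\chi_{\epsilon,k}$ be the one-dimensional character of $G(r,p,s,n)$ given by $\chi_{\epsilon,k}(g)=\epsilon^{\mathrm{inv}(|g|)}\zeta_r^{k\cdot c(g)}$. Then, with $m=\lfloor n/2\rfloor$, $$\sum_{g\in G(r,p,s,n)}\chi_{\epsilon,k}(g)\,q^{\mathrm{fmaj}(g)}=\left[\frac{r}{p}\right]_{(\zeta^{k}q)^p}\left[\frac{2r}{p}\right]_{(\epsilon\zeta^{k}q)^p}\cdots\left[\frac{(n-1)r}{p}\right]_{(\epsilon^{n-2}\zeta^{k}q)^p}\left[\frac{nr}{ps}\right]_{(\epsilon^{n-1}\zeta^{k}q)^{p}}\left\{[p]_{\zeta^{k}q}^{\,n-m}\,[p]_{\epsilon\zeta^{k}q}^{\,m}\right\}_{q^p}.$$ (The product runs over the factors $\left[\frac{ir}{p}\right]_{(\epsilon^{i-1}\zeta^k q)^p}$ for $1\le i\le n-1$, followed by the factor $\left[\frac{nr}{ps}\right]_{(\epsilon^{n-1}\zeta^k q)^p}$.)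
   Context: Notation. For a positive integer $m$, $R_m(i)\in\{0,\ldots,m-1\}$ denotes the residue of $i\in\mathbb Z$ modulo $m$. $[m]_x=1+x+\cdots+x^{m-1}$. For a polynomial $F$ in $q$, $\{F\}_{q^p}$ is the polynomial obtained from $F$ by discarding all terms whose degree in $q$ is not divisible by $p$. Groups. $G(r,n)$ is the group of pairs $(c_1,\ldots,c_n;\sigma)$ with $c_i\in\{0,\ldots,r-1\}$ (the colors) and $\sigma\in S_n$, with product $(d_1,\ldots,d_n;\tau)(c_1,\ldots,c_n;\sigma)=(R_r(c_1+d_{\sigma(1)}),\ldots,R_r(c_n+d_{\sigma(n)});\tau\sigma)$. For $p\mid r$, $G(r,p,n)$ is the subgroup of elements with $c_1+\cdots+c_n\equiv 0 \bmod p$. For $s\mid r$ with $ps\mid rn$, $C_s\subseteq G(r,p,n)$ is the cyclic subgroup of order $s$ generated by $(r/s,\ldots,r/s;\mathrm{id})$, and $G(r,p,s,n)=G(r,p,n)/C_s$. For $g\in G(r,p,s,n)$ the class of $(c_1,\ldots,c_n;\sigma)$, $|g|=\sigma$, and $c(g)=c_1+\cdots+c_n$ is the sum of the colors of any representative of $g$ in $G(r,p,n)$ (the value $\zeta_r^{k c(g)}$ does not depend on the representative when $s\mid kn$). $\mathrm{inv}(\sigma)$ is the number of pairs $i<j$ with $\sigma(i)>\sigma(j)$. Flag major index. For $g\in G(r,p,s,n)$ represented by $(c_1,\ldots,c_n;\sigma)$ let $\mathrm{HDes}(g)=\{i\in\{1,\ldots,n-1\}: c_i=c_{i+1},\ \sigma(i)>\sigma(i+1)\}$,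 $h_i(g)=\#\{j\ge i: j\in\mathrm{HDes}(g)\}$, $k_n(g)=R_{r/s}(c_n)$, $k_i(g)=k_{i+1}(g)+R_r(c_i-c_{i+1})$ for $1\le i\le n-1$, $\lambda_i(g)=r\,h_i(g)+k_i(g)$, and $\mathrm{fmaj}(g)=\sum_{i=1}^n\lambda_i(g)$. These do not depend on the representative chosen. *)

(* Defs.v *)
From HB Require Import structures.
From mathcomp Require Import all_boot all_order all_algebra all_fingroup.
From mathcomp Require Import complex.
From mathcomp Require Import reals trigo.

Set Implicit Arguments.
Unset Strict Implicit.
Unset Printing Implicit Defensive.

Import GRing.Theory.

(* Elements of G(r,n).  Colors live in 'I_r.-1.+1, which is {0, ..., r-1} for
   r > 0 and carries addition modulo r.  Positions 1, ..., n of the literature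
   are the elements 0, ..., n-1 of 'I_n. *)
Record colored_perm (r n : nat) := ColoredPerm {
  colors : {ffun 'I_n -> 'I_r.-1.+1};
  uperm : 'S_n
}.

Section ColoredPermGroup.
Variables r n : nat.
Local Notation G := (colored_perm r n).

Definition colored_perm_to_pair (g : G) := (colors g, uperm g).
Definition colored_perm_of_pair u : G := ColoredPerm u.1 u.2.

Lemma colored_perm_to_pairK : cancel colored_perm_to_pair colored_perm_of_pair.
Proof. by case. Qed.

HB.instance Definition _ := Equality.copy G (can_type colored_perm_to_pairK).
HB.instance Definition _ := Choice.copy G (can_type colored_perm_to_pairK).
HB.instance Definition _ := Countable.copy G (can_type colored_perm_to_pairK).
HB.instance Definition _ := Finite.copy G (can_type colored_perm_to_pairK).

(* (d; tau) (c; sigma) = (c_i + d_(sigma i); tau o sigma).  Products in 'S_n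
   compose from left to right, so tau o sigma is (sigma * tau)%g. *)
Definition colored_perm_mul (x y : G) : G :=
  ColoredPerm [ffun i => (colors y i + colors x (uperm y i))%R]
              (uperm y * uperm x)%g.

Definition colored_perm_one : G := ColoredPerm [ffun=> 0%R] 1%g.

Definition colored_perm_inv (x : G) : G :=
  ColoredPerm [ffun i => (- colors x ((uperm x)^-1%g i))%R] (uperm x)^-1%g.

Lemma colored_perm_mulA : associative colored_perm_mul.
Proof.
move=> x y z; rewrite /colored_perm_mul /= mulgA; congr ColoredPerm.
by apply/ffunP=> i; rewrite !ffunE /= permM addrA.
Qed.

Lemma colored_perm_mul1 : left_id colored_perm_one colored_perm_mul.
Proof.
case=> c s; rewrite /colored_perm_mul /= mulg1; congr ColoredPerm.
by apply/ffunP=> i; rewrite !ffunE addr0.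
Qed.

Lemma colored_perm_mulV :
  left_inverse colored_perm_one colored_perm_inv colored_perm_mul.
Proof.
case=> c s; rewrite /colored_perm_mul /colored_perm_one /= mulgV.
by congr ColoredPerm; apply/ffunP=> i; rewrite !ffunE permK addrN.
Qed.

HB.instance Definition _ := Finite_isGroup.Build G
  colored_perm_mulA colored_perm_mul1 colored_perm_mulV.

End ColoredPermGroup.

Section ProjectiveReflectionGroups.
Variables r p s n : nat.

Definition color_sum (g : colored_perm r n) : nat := \sum_(i < n) colors g i.

(* The set G(r,p,n); it is a group as soon as 0 < r and p %| r. *)
Definition Grpn : {set colored_perm r n} := [set g | p %| color_sum g].

(* inZp reduces modulo r, which matters when s = 1. *)
Definition Cs_gen : colored_perm r n := ColoredPerm [ffun=> inZp (r %/ s)] 1%g.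

Definition Cs : {set colored_perm r n} := <[Cs_gen]>%g.

Definition Grpsn : {set coset_of Cs} := (Grpn / Cs)%g.

Lemma val_inZp_color (i : nat) : 0 < r -> val (inZp i : 'I_r.-1.+1) = i %% r.
Proof. by move=> r_gt0; rewrite /=; congr (_ %% _); apply: prednK. Qed.

Lemma color_sumM (x y : colored_perm r n) : 0 < r ->
  color_sum (x * y)%g = color_sum x + color_sum y %[mod r].
Proof.
move=> r_gt0; rewrite /color_sum.
have -> : \sum_(i < n) colors x i = \sum_(i < n) colors x (uperm y i).
  exact: (reindex_inj (@perm_inj _ (uperm y))).
rewrite addnC -big_split /= -[LHS]modn_summ -[RHS]modn_summ.
congr (_ %% _); apply: eq_bigr => i _; rewrite ffunE.
by rewrite [nat_of_ord _](val_inZp_color _ r_gt0) modn_mod.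
Qed.

Lemma Grpn_group_set : 0 < r -> p %| r -> group_set Grpn.
Proof.
move=> r_gt0 p_r; apply/group_setP; split=> [|x y].
  rewrite inE /color_sum big1 // => i _.
  by rewrite ffunE.
rewrite !inE => px py; rewrite /dvdn -(modn_dvdm _ p_r) color_sumM //.
by rewrite modn_dvdm // -/(dvdn _ _) dvdn_add.
Qed.

Lemma Cs_gen_central (x : colored_perm r n) : commute x Cs_gen.
Proof.
case: x => c t; rewrite /commute /mulg /= /colored_perm_mul /= mulg1 mul1g.
by congr ColoredPerm; apply/ffunP=> i; rewrite !ffunE /= perm1 addrC.
Qed.

Lemma Cs_sub_Grpn : 0 < r -> p %| r -> 0 < s -> s %| r -> p * s %| r * n ->
  Cs \subset Grpn.
Proof.
move=> r_gt0 p_r s_gt0 s_r ps_rn.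
rewrite -[Grpn]/(gval (Group (Grpn_group_set r_gt0 p_r))) cycle_subG /= inE.
rewrite /dvdn -(modn_dvdm _ p_r) /color_sum -modn_summ.
under eq_bigr do
  rewrite ffunE [nat_of_ord _](val_inZp_color _ r_gt0) modn_mod.
rewrite modn_summ modn_dvdm // sum_nat_const card_ord -/(dvdn _ _).
by rewrite -(dvdn_pmul2r s_gt0) -mulnA divnK // mulnC [n * _]mulnC mulnC.
Qed.

Lemma Grpn_norm_Cs : Grpn \subset 'N(Cs)%g.
Proof.
apply/(subset_trans _ (cent_sub _))/subsetP=> x _.
by rewrite cent_cycle; apply/cent1P; apply: Cs_gen_central.
Qed.

End ProjectiveReflectionGroups.

Definition perm_inv_count (n : nat) (sigma : 'S_n) : nat :=
  #|[set ij : 'I_n * 'I_n | (ij.1 < ij.2) && (sigma ij.2 < sigma ij.1)]|.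

Definition residue (m : nat) (i : int) : nat := `|(i %% m)%Z|%N.

Section FlagMajorIndex.
Variables r s n : nat.

Definition HDes (g : colored_perm r n) : {set 'I_n} :=
  [set i : 'I_n | [exists j : 'I_n,
    [&& val j == i.+1, colors g i == colors g j & uperm g j < uperm g i]]].

Definition hstat (g : colored_perm r n) (i : nat) : nat :=
  #|[set j in HDes g | i <= j]|.

(* Color at the 0-based position i; the default 0 is never used below n. *)
Definition color_at (g : colored_perm r n) (i : nat) : nat :=
  if insub i is Some j then colors g (j : 'I_n) else 0.

(* kstat_end g j is k_(n-j), by recursion from the last position. *)
Fixpoint kstat_end (g : colored_perm r n) (j : nat) : nat :=
  if j is j'.+1 then
    kstat_end g j' +
    residue r ((color_at g (n.-1 - j))%:Z - (color_at g (n.-1 - j'))%:Z)%R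
  else residue (r %/ s) (color_at g n.-1)%:Z.

Definition kstat (g : colored_perm r n) (i : nat) : nat :=
  kstat_end g (n.-1 - i).

Definition lambda_stat (g : colored_perm r n) (i : nat) : nat :=
  r * hstat g i + kstat g i.

Definition fmaj_rep (g : colored_perm r n) : nat :=
  \sum_(i < n) lambda_stat g i.

(* Independent of the representative, here repr g. *)
Definition fmaj (g : coset_of (Cs r s n)) : nat := fmaj_rep (repr g).

End FlagMajorIndex.

Local Open Scope ring_scope.

(* e^(2 pi i / r) *)
Definition zeta (R : realType) (r : nat) : R[i] :=
  Complex (cos (2 * pi / r%:R)) (sin (2 * pi / r%:R)).

(* Independent of the representative repr g when s %| k * n. *)
Definition chi (R : realType) (r s n : nat) (eps : R[i]) (k : nat)
    (g : coset_of (Cs r s n)) : R[i] :=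
  eps ^+ perm_inv_count (uperm (repr g)) * zeta R r ^+ (k * color_sum (repr g)).

(* [m]_x *)
Definition qint (A : nzRingType) (m : nat) (x : A) : A := \sum_(i < m) x ^+ i.

(* {F}_{q^p} *)
Definition keep_mult (A : nzRingType) (p : nat) (F : {poly A}) : {poly A} :=
  \poly_(i < size F) (if (p %| i)%N then F`_i else 0).

(* Main.v *)
Require Import Defs.
From mathcomp Require Import all_boot all_order all_algebra all_fingroup.
From mathcomp Require Import complex.
From mathcomp Require Import reals trigo.
From mathcomp Require Import cyclic zify ring.
Import GRing.Theory.
Local Open Scope ring_scope.

Set Implicit Arguments.
Unset Strict Implicit.
Unset Printing Implicit Defensive.

(* Put x = zeta^k q and t = r/s.  Since lambda_i is congruent modulo r to
   c_i - c_n + R_t(c_n), s | kn yields chi(g) q^fmaj(g) = eps^inv x^fmaj(g), and p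
   divides the color sum iff it divides fmaj.  Hence s times the left-hand side
   is {.}_(q^p) applied to the sum of eps^inv x^fmaj over the whole of G(r,n).
   In terms of the differences e_i = c_i - c_(i+1) mod r, fmaj is
   n R_t(c_n) + sum_i i (e_i + r [i is a descent of sigma and e_i = 0]), so that
   the sum over the colors factors, leaving the signed Mahonian sum of
   eps^inv x^maj over S_n; the latter is computed by rotating the values of
   the permutation.  Finally [ir]_y = [p]_y [ir/p]_(y^p), and the factors in
   y^p are taken out of {.}_(q^p). *)

(** * Factorization of q-integers *)

Section QIntegers.
Variable A : comNzRingType.
Implicit Types x y e : A.

(** The exponents below [a * b] fall into [b] blocks of length [a]. Used with [a = i.+1] to merge a
    Mahonian factor with a color factor, and with [a = p] to separate the powers of [x ^+ p]. *)
Lemma qintM (a b : nat) x : qint (a * b) x = qint a x * qint b (x ^+ a).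
Proof.
rewrite /qint; elim: b => [|b IHb]; first by rewrite muln0 !big_ord0 mulr0.
rewrite mulnS addnC big_split_ord /= IHb big_ord_recr /= mulrDr; congr (_ + _).
rewrite mulr_suml; apply: eq_bigr => i _.
by rewrite exprD -exprM mulrC.
Qed.

End QIntegers.

(** Identifies ['S_n] with the stabilizer of the last point; the inverse deletes that point. *)
Lemma lift_perm_max_bij n :
  {on [pred s : 'S_n.+1 | s ord_max == ord_max],
    bijective (lift_perm ord_max ord_max : 'S_n -> 'S_n.+1)}.
Proof.
pose down (s : 'S_n.+1) k := odflt k (unlift ord_max (s (lift ord_max k))).
have downK (s : 'S_n.+1) : s ord_max = ord_max ->
    forall k, lift ord_max (down s k) = s (lift ord_max k).
  move=> smax k; rewrite /down; case: unliftP => //= eq_max.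
  by have /eqP := neq_lift ord_max k; case; apply/(@perm_inj _ s); rewrite smax.
have down_perm (s : 'S_n.+1) : s ord_max = ord_max -> exists t : 'S_n, t =1 down s.
  move=> smax; have down_inj : injective (down s).
    by move=> k l /(congr1 (lift ord_max)); rewrite !downK // => /perm_inj/lift_inj.
  by exists (perm down_inj) => k; rewrite permE.
(* The inverse has to be total: it is the permutation given by [down s], or the identity when there
   is none. *)
pose g (s : 'S_n.+1) : 'S_n := odflt 1%g [pick t : 'S_n | [forall k, t k == down s k]].
exists g => [t _ | s /eqP smax].
  have tE k : down (lift_perm ord_max ord_max t) k = t k.
    by apply: (@lift_inj _ ord_max); rewrite downK ?lift_perm_id // lift_perm_lift.
  rewrite /g; case: pickP => [u /forallP uE | /(_ t)/negP[]]; last first.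
    by apply/forallP => k; rewrite tE.
  by apply/permP => k; rewrite /= (eqP (uE k)) tE.
have [t tE] := down_perm s smax.
rewrite /g; case: pickP => [u /forallP uE | /(_ t)/negP[]]; last first.
  by apply/forallP => k; rewrite tE.
apply/permP => k; case: (unliftP ord_max k) => [l|] ->; last by rewrite lift_perm_id.
by rewrite lift_perm_lift /= (eqP (uE l)) downK.
Qed.

(** * Inversion statistics with weights on pairs of positions *)

Section WeightedInversions.
Variables (w : nat -> nat -> nat).

(** One statistic covers both [inv] and [maj], so that the effect of a rotation is computed only
    once. *)
Definition inv_weight n (s : 'S_n) : nat :=
  (\sum_(i < n) \sum_(j < n) w i j * (s j < s i))%N.

Lemma inv_weight_lift n (t : 'S_n) : (forall i j, j < i -> w i j = 0)%N ->
  inv_weight (lift_perm ord_max ord_max t) = inv_weight t.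
Proof.
move=> w0; rewrite /inv_weight big_ord_recr /= [X in (_ + X)%N]big1 ?addn0; last first.
  move=> j _; rewrite lift_perm_id; have [ltjn|] := ltnP j n; first by rewrite w0.
  move=> lenj; have -> : j = ord_max.
    by apply/val_inj/eqP; rewrite /= eqn_leq lenj -ltnS ltn_ord.
  by rewrite lift_perm_id ltnn muln0.
have liftE (i : 'I_n) : widen_ord (leqnSn n) i = lift ord_max i.
  by apply: val_inj; rewrite /= /bump leqNgt ltn_ord.
have lift_val (i : 'I_n) : lift ord_max i = i :> nat by rewrite -liftE.
apply: eq_bigr => i _; rewrite big_ord_recr /= lift_perm_id liftE lift_perm_lift.
rewrite lift_val [(n < _)%N]ltnNge (ltnW (ltn_ord _)) muln0 addn0.
by apply: eq_bigr => j _; rewrite liftE lift_perm_lift !lift_val.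
Qed.

(** Products act from left to right, so [s * rotate n] rotates the values of [s], not its
    positions. *)
Definition rotate n : 'S_n.+1 := perm (addIr (inord 1 : 'I_n.+1)).

Lemma rotateE n (i : 'I_n.+1) : rotate n i = (if i == n :> nat then 0 else i.+1)%N :> nat.
Proof.
rewrite permE /=; case: n i => [|n] i; first by rewrite ord1 /= modn1.
rewrite inordK //; case: eqP => [->|neq]; first by rewrite addn1 modnn.
by rewrite addn1 modn_small //; have := ltn_ord i; lia.
Qed.

(* Only the comparisons with the largest value, which becomes the smallest
   one, are reversed. *)
Lemma inv_weight_rotate n (s : 'S_n.+1) (m : 'I_n.+1) : s m = ord_max ->
  (inv_weight (s * rotate n)%g + \sum_(j < n.+1) w m j
   = inv_weight s + \sum_(i < n.+1) w i m)%N.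
Proof.
move=> smax; have sE i : (s i == n :> nat) = (i == m).
  by rewrite -[LHS]/(s i == ord_max) -smax (inj_eq (@perm_inj _ s)).
(* Row and column sums are spread over all pairs, which reduces the claim to an identity of truth
   values for each pair [(i, j)]. *)
have rowE : (\sum_(j < n.+1) w m j =
    \sum_(i < n.+1) \sum_(j < n.+1) w i j * (s i == n :> nat))%N.
  rewrite [RHS](bigD1 m) //= sE eqxx [X in (_ = _ + X)%N]big1 ?addn0; last first.
    by move=> i nim; rewrite sE (negPf nim) big1 // => j _; rewrite muln0.
  by apply: eq_bigr => j _; rewrite muln1.
have colE : (\sum_(i < n.+1) w i m =
    \sum_(i < n.+1) \sum_(j < n.+1) w i j * (s j == n :> nat))%N.
  apply: eq_bigr => i _; rewrite (bigD1 m) //= sE eqxx muln1 big1 ?addn0 //.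
  by move=> j njm; rewrite sE (negPf njm) muln0.
rewrite rowE colE /inv_weight -!big_split; apply: eq_bigr => i _.
rewrite -!big_split; apply: eq_bigr => j _ /=.
rewrite -!mulnDr !permM !rotateE; congr (_ * _)%N.
have := ltn_ord (s i); have := ltn_ord (s j).
by case: eqP; case: eqP; lia.
Qed.

End WeightedInversions.

(** * Inversions and major index under rotation *)

Definition inv_kernel (i j : nat) : nat := (i < j)%N.
Definition maj_kernel (i j : nat) : nat := ((j == i.+1) * i.+1)%N.
Local Notation inv := (inv_weight inv_kernel).
Local Notation maj := (inv_weight maj_kernel).

Lemma perm_inv_countE n (s : 'S_n) : perm_inv_count s = inv s.
Proof.
rewrite /perm_inv_count /inv_weight -sum1dep_card.
rewrite big_mkcond pair_bigA /=; apply: eq_bigr => -[i j] _ /=.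
by rewrite /inv_kernel; case: (i < j)%N; case: (_ < _)%N.
Qed.

(** The largest value is inverted with the [n - m] later positions; once it has become the smallest,
    with the [m] earlier ones. *)
Lemma inv_rotate n (s : 'S_n.+1) (m : 'I_n.+1) : s m = ord_max ->
  (inv (s * rotate n)%g + (n - m) = inv s + m)%N.
Proof.
move=> smax; have := inv_weight_rotate inv_kernel smax.
have -> : (\sum_(j < n.+1) inv_kernel m j = n - m)%N.
  rewrite /inv_kernel; have := ltn_ord m; move: (nat_of_ord m) => l.
  elim: n {s m smax} => [|n IHn] ltl; rewrite big_ord_recr /=.
    by rewrite big_ord0; lia.
  have [ltln|lenl] := ltnP l n.+1; first by rewrite IHn //; lia.
  by rewrite big1 => [|i _]; [lia | have := ltn_ord i; lia].
suff -> : (\sum_(i < n.+1) inv_kernel i m = m)%N by [].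
rewrite /inv_kernel; have := ltn_ord m; move: (nat_of_ord m) => l.
elim: n {s m smax} => [|n IHn] ltl; rewrite big_ord_recr /=.
  by rewrite big_ord0; lia.
have [ltln|lenl] := ltnP l n.+1; first by rewrite IHn //; lia.
have -> : l = n.+1 by lia.
under eq_bigr => i _ do rewrite ltn_ord.
by rewrite sum_nat_const card_ord; lia.
Qed.

(** If the largest value stands at [m < n], the rotation turns the descent at [m], of weight [m.+1],
    into an ascent and creates one just before it, of weight [m] (none if [m = 0]). *)
Lemma maj_rotate n (s : 'S_n.+1) : s ord_max != ord_max ->
  (maj (s * rotate n)%g).+1 = maj s.
Proof.
move=> smax; pose m := (s^-1)%g ord_max.
have sm : s m = ord_max by rewrite permKV.
have := inv_weight_rotate maj_kernel sm.
have ltmn : (m < n)%N.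
  have : m != ord_max by apply: contra smax => /eqP {1}<-; rewrite sm.
  by rewrite -val_eqE /=; have := ltn_ord m; lia.
have -> : (\sum_(j < n.+1) maj_kernel m j = m.+1)%N.
  rewrite (bigD1 (Ordinal (ltmn : m.+1 < n.+1)%N)) //= {1}/maj_kernel eqxx mul1n.
  by rewrite big1 ?addn0 // => j; rewrite -val_eqE /maj_kernel /= => /negPf->.
suff -> : (\sum_(i < n.+1) maj_kernel i m = m)%N by lia.
have := ltn_ord m; move: (nat_of_ord m) => [|l] ltl.
  by rewrite big1.
rewrite (bigD1 (Ordinal (ltnW ltl))) //= /maj_kernel eqxx mul1n.
rewrite big1 ?addn0 // => j; rewrite -val_eqE /= eqSS eq_sym => /negPf-> //.
Qed.

(** * The signed Mahonian identity *)

Section SignedMahonian.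
Variables (A : comNzRingType) (e y : A).
Hypothesis e2 : e ^+ 2 = 1.

Definition signed_maj n (s : 'S_n) : A := e ^+ inv s * y ^+ maj s.

(** The rotation changes [inv] by [2m - n], with [m] the position of the largest value; as
    [e ^+ 2 = 1], the sign depends on [n] only. *)
Lemma signed_maj_rotate n (s : 'S_n.+1) : s ord_max != ord_max ->
  signed_maj s = e ^+ n * y * signed_maj (s * rotate n)%g.
Proof.
move=> smax; rewrite /signed_maj -(maj_rotate smax) mulrACA -exprS; congr (_ * _).
have [] := (inv_rotate (permKV s ord_max), ltn_ord ((s^-1)%g ord_max)).
move: (nat_of_ord _) (inv s) (inv (s * rotate n)%g) => m b a ab ltm.
have eD2 c d : e ^+ (c + d + d) = e ^+ c.
  by rewrite -addnA addnn -mul2n exprD exprM e2 expr1n mulr1.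
rewrite -exprD -(eD2 b m) -ab; congr (_ ^+ _); lia.
Qed.

(* The permutations are sorted by their last value; rotating the values turns
   last value j < n into j+1 and lowers the major index by one. *)
Lemma signed_mahonian n :
  \sum_(s : 'S_n) signed_maj s = \prod_(i < n) qint i.+1 (e ^+ i * y).
Proof.
elim: n => [|n IHn].
  rewrite big_ord0 (bigD1 (1%g : 'S_0)) //= big1 => [|s /eqP[]]; last first.
    by apply/permP=> -[].
  by rewrite addr0 /signed_maj /inv_weight !big_ord0 mulr1.
pose T (j : 'I_n.+1) := \sum_(s : 'S_n.+1 | s ord_max == j) signed_maj s.
(* The last value [rev_ord (inord m)] is [n - m], which [m] rotations bring to [n]. *)
have T_rot m : (m <= n)%N -> T (rev_ord (inord m)) = (e ^+ n * y) ^+ m * T ord_max.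
  elim: m => [|m IHm] ltmn.
    by rewrite mul1r; congr T; apply: val_inj; rewrite /= inordK // subn1.
  rewrite exprS -mulrA -IHm ?(ltnW ltmn) // /T mulr_sumr.
  rewrite [RHS](reindex_inj (mulIg (rotate n))) /=.
  have rev_neq : rev_ord (inord m.+1) != @ord_max n.
    by rewrite -val_eqE /= inordK //; lia.
  apply: eq_big => [s | s /eqP smax]; last by rewrite -signed_maj_rotate // smax.
  rewrite -!val_eqE /= permM rotateE !inordK //; last exact: ltnW.
  move: (nat_of_ord _) (ltn_ord (s ord_max)) => l ltl.
  by case: (l =P n); lia.
have -> : \sum_(s : 'S_n.+1) signed_maj s = \sum_(j < n.+1) T j.
  by rewrite (partition_big (fun s : 'S_n.+1 => s ord_max) predT).
rewrite (reindex_inj rev_ord_inj) /=.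
have -> : \sum_(j < n.+1) T (rev_ord j) = qint n.+1 (e ^+ n * y) * T ord_max.
  rewrite /qint mulr_suml; apply: eq_bigr => j _.
  by rewrite -{1}(inord_val j) T_rot // -ltnS.
rewrite big_ord_recr /= mulrC -IHn; congr (_ * _).
(* Deleting a largest last value changes neither [inv] nor [maj]. *)
rewrite /T (reindex (lift_perm ord_max ord_max)); last first.
  exact: lift_perm_max_bij.
apply: eq_big => [s|s _]; first by rewrite lift_perm_id eqxx.
by rewrite /signed_maj !inv_weight_lift // /inv_kernel /maj_kernel => i j; lia.
Qed.

End SignedMahonian.

Lemma maj_descents N (s : 'S_N.+1) :
  maj s = (\sum_(j < N) j.+1 * (s (lift ord0 j) < s (widen_ord (leqnSn N) j)))%N.
Proof.
rewrite /inv_weight big_ord_recr /= [X in (_ + X)%N]big1 ?addn0; last first.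
  by move=> j _; rewrite /maj_kernel (ltn_eqF (ltn_ord j)).
apply: eq_bigr => i _; rewrite (bigD1 (lift ord0 i)) //= {1}/maj_kernel eqxx mul1n.
rewrite [X in (_ + X)%N]big1 ?addn0 // => j; rewrite -val_eqE /maj_kernel /= => /negPf.
by rewrite /bump /= add1n => ->.
Qed.

(** * Coordinates by differences of neighbouring colors *)

Section ColorDifferences.
Variables (r N : nat).
Implicit Types c d : {ffun 'I_N.+1 -> 'I_r.-1.+1}.

(** The last coordinate keeps the color itself, so that all colors can be recovered backwards from
    it. *)
Definition color_diff c : {ffun 'I_N.+1 -> 'I_r.-1.+1} :=
  [ffun j : 'I_N.+1 => if (j < N)%N then c j - c (inord j.+1) else c j].

Lemma color_diff_widen c (j : 'I_N) :
  color_diff c (widen_ord (leqnSn N) j) = c (widen_ord (leqnSn N) j) - c (lift ord0 j).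
Proof.
rewrite ffunE /= ltn_ord; congr (_ - c _).
by apply: val_inj; rewrite /= inordK // ltnS.
Qed.

Lemma color_diff_max c : color_diff c ord_max = c ord_max.
Proof. by rewrite ffunE /= ltnn. Qed.

Lemma color_diff_inj : injective color_diff.
Proof.
move=> c d eq_cd; apply/ffunP.
suff eq_from m (j : 'I_N.+1) : (N - j = m)%N -> c j = d j by move=> j; apply: eq_from.
elim: m j => [|m IHm] j Njm; move/ffunP/(_ j): eq_cd; rewrite !ffunE.
  by rewrite ltnNge -subn_eq0 Njm.
have ltjN : (j < N)%N by lia.
rewrite ltjN (IHm (inord j.+1)); last by rewrite inordK //; lia.
by move/(congr1 (+%R^~ (d (inord j.+1)))); rewrite !subrK.
Qed.

End ColorDifferences.

Lemma residue_ordB m (a b : 'I_m.+1) :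
  residue m.+1 ((a : nat)%:Z - (b : nat)%:Z) = (a - b)%R :> nat.
Proof.
have ltb := ltn_ord b; rewrite /residue /=.
rewrite modnDmr -{1}(modzDr _ m.+1%:Z).
have -> : (a : nat)%:Z - (b : nat)%:Z + m.+1%:Z = (a + (m.+1 - b))%N%:Z by lia.
by rewrite modz_nat absz_nat.
Qed.

(** * The flag major index in terms of color differences *)

Section FlagMajor.
Variables (r s N : nat).
Hypothesis r_gt0 : (0 < r)%N.
Implicit Type g : colored_perm r N.+1.

Local Notation wd := (widen_ord (leqnSn N)).

Lemma color_atE g (i : 'I_N.+1) : color_at g i = colors g i.
Proof. by rewrite /color_at valK. Qed.

Lemma kstat_endE g m : (m <= N)%N ->
  kstat_end s g m
  = (colors g ord_max %% (r %/ s)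
     + \sum_(j < N) (N - m <= j) * color_diff (colors g) (wd j))%N.
Proof.
elim: m => [|m IHm] lemN /=.
  rewrite (color_atE g ord_max) /residue modz_nat absz_nat big1 ?addn0 // => j _.
  by rewrite subn0 leqNgt ltn_ord.
have ltN : (N - m.+1 < N)%N by lia.
rewrite IHm ?(ltnW lemN) // -addnA; congr addn.
rewrite (bigD1 (Ordinal ltN)) // [RHS](bigD1 (Ordinal ltN)) //=.
rewrite leqnn mul1n [(_ <= _)%N]leqNgt (_ : (_ < _)%N) ?mul0n ?add0n; last by lia.
rewrite addnC; congr addn; last first.
  apply: eq_bigr => j; rewrite -val_eqE /= => jneq; congr ((nat_of_bool _) * _)%N; lia.
rewrite color_diff_widen -residue_ordB -(color_atE g (wd _)).
rewrite -(color_atE g (lift _ _)) prednK //=.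
by rewrite /bump /= add1n (_ : (N - m.+1).+1 = N - m)%N; last by lia.
Qed.

(** Indexed by ['I_N], as the last position never lies in [HDes]. *)
Definition hdes g (j : 'I_N) : bool :=
  (color_diff (colors g) (wd j) == 0) && (uperm g (lift ord0 j) < uperm g (wd j))%N.

Lemma hstatE g i : hstat g i = (\sum_(j < N) (i <= j) * hdes g j)%N.
Proof.
rewrite /hstat -sum1dep_card big_mkcond big_ord_recr /=.
rewrite [X in (_ + (if X then _ else _))%N](_ : _ = false) ?addn0; last first.
  apply/negbTE/negP=> /andP[]; rewrite inE => /existsP[j /and3P[/eqP jE _ _]] _.
  by have := ltn_ord j; rewrite jE ltnn.
apply: eq_bigr => j _; rewrite mulnb andbC -[LHS]/(nat_of_bool (_ && _)).
congr (nat_of_bool (_ && _)); rewrite inE /hdes color_diff_widen subr_eq0.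
apply/existsP/idP => [[k /and3P[/eqP kE cE sE]] | /andP[cE sE]].
  by have -> : lift ord0 j = k; [apply: val_inj | rewrite cE].
by exists (lift ord0 j); rewrite eqxx cE.
Qed.

(** The term of position [j] occurs in [lambda_stat] for the [j.+1] indices [i <= j], the residue of
    the last color for all [N.+1]. *)
Lemma fmaj_repE g :
  fmaj_rep s g
  = (N.+1 * (colors g ord_max %% (r %/ s))
     + \sum_(j < N) j.+1 * (r * hdes g j + color_diff (colors g) (wd j)))%N.
Proof.
rewrite /fmaj_rep.
have lamE (i : 'I_N.+1) : lambda_stat s g i = (colors g ord_max %% (r %/ s)
    + \sum_(j < N) (i <= j) * (r * hdes g j + color_diff (colors g) (wd j)))%N.
  rewrite /lambda_stat /kstat hstatE kstat_endE /= ?leq_subr // subKn -1?ltnS //.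
  rewrite addnCA big_distrr -big_split /=; congr addn; apply: eq_bigr => j _.
  by rewrite mulnDr mulnCA.
under eq_bigr => i _ do rewrite lamE.
rewrite big_split sum_nat_const card_ord /=; congr addn.
rewrite exchange_big; apply: eq_bigr => j _; rewrite -big_distrl /=; congr muln.
have := ltn_ord j; move: (nat_of_ord j) => l ltl.
transitivity (\sum_(i < l.+1) 1)%N; last by rewrite sum_nat_const card_ord muln1.
rewrite (@big_ord_widen _ _ _ l.+1 N.+1 (fun=> 1%N)) 1?ltnW // [RHS]big_mkcond /=.
by apply: eq_bigr => i _; rewrite ltnS; case: leq.
Qed.

End FlagMajor.

(** * The signed sum over the whole of $G(r,n)$ *)

Section TotalSum.
Variables (A : comNzRingType) (e y : A).
Hypothesis e2 : e ^+ 2 = 1.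

(** Applied to the last color, this yields the factor [s] that finally cancels against the order of
    $C_s$. *)
Lemma sum_modn (f : nat -> A) t s :
  \sum_(a < t * s) f (a %% t)%N = (\sum_(a < t) f a) *+ s.
Proof.
elim: s => [|s IHs]; first by rewrite muln0 big_ord0.
rewrite mulnS mulrS big_split_ord -IHs /=; congr (_ + _).
  by apply: eq_bigr => a _; rewrite modn_small.
by apply: eq_bigr => a _; rewrite modnDl.
Qed.

(** For [b = true] the value [a = 0] counts as [r.+1], so [a] effectively runs from [1] to [r.+1]:
    the geometric sum is shifted by one factor [y ^+ m]. *)
Lemma sum_shift_first (m r : nat) (b : bool) :
  \sum_(a < r.+1) y ^+ (m * (r.+1 * ((a == 0 :> nat) && b) + a))
  = y ^+ (m * b) * qint r.+1 (y ^+ m).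
Proof.
case: b; last first.
  rewrite muln0 mul1r; apply: eq_bigr => a _.
  by rewrite andbF muln0 add0n exprM.
rewrite big_ord_recl /qint big_ord_recr /= !muln1 addn0 mulrDr addrC; congr (_ + _).
  rewrite mulr_sumr; apply: eq_bigr => a _; rewrite muln0 add0n /bump /= add1n.
  by rewrite -exprS -exprM.
by rewrite -exprM -exprD -mulnS.
Qed.

Variables (r s N : nat).
Hypotheses (r_gt0 : (0 < r)%N) (s_dvd_r : (s %| r)%N).
Local Notation t := (r %/ s)%N.

(** In difference coordinates each term of the exponent involves a single coordinate, so the sum is
    a product over positions; [u] enters only through [y ^+ maj u]. *)
Lemma sum_colors (u : 'S_N.+1) :
  \sum_c y ^+ fmaj_rep s (ColoredPerm c u : colored_perm r N.+1)
  = (qint t (y ^+ N.+1) *+ s) * (y ^+ maj u * \prod_(j < N) qint r (y ^+ j.+1)).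
Proof.
pose des (j : 'I_N) := (u (lift ord0 j) < u (widen_ord (leqnSn N) j))%N.
pose F (j : 'I_N.+1) (a : 'I_r.-1.+1) := if insub (val j) is Some j'
  then y ^+ (j.+1 * (r * ((a == 0 :> nat) && des j') + a)) else y ^+ (N.+1 * (a %% t)).
have Fwd (j : 'I_N) a : F (widen_ord (leqnSn N) j) a
    = y ^+ (j.+1 * (r * ((a == 0 :> nat) && des j) + a)) by rewrite /F /= valK.
have Fmax a : F ord_max a = y ^+ (N.+1 * (a %% t)).
  by rewrite /F insubF //= ltnn.
transitivity (\sum_(d : {ffun 'I_N.+1 -> 'I_r.-1.+1}) \prod_j F j (d j)).
  rewrite [RHS](reindex_inj (@color_diff_inj r N)); apply: eq_bigr => c _.
  rewrite big_ord_recr /= Fmax color_diff_max fmaj_repE //= exprD mulrC.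
  rewrite expr_sum; congr (_ * _); apply: eq_bigr => j _.
  by rewrite Fwd.
rewrite -bigA_distr_bigA big_ord_recr /= mulrC; congr (_ * _).
  under eq_bigr => a _ do rewrite Fmax exprM.
  rewrite prednK //; have := sum_modn (fun a => (y ^+ N.+1) ^+ a) t s.
  by rewrite divnK.
rewrite maj_descents expr_sum -big_split; apply: eq_bigr => j _ /=.
under eq_bigr => a _ do rewrite Fwd.
by have := sum_shift_first j.+1 r.-1 (des j); rewrite prednK.
Qed.

Lemma sum_signed_fmaj :
  \sum_(x : colored_perm r N.+1) e ^+ inv (uperm x) * y ^+ fmaj_rep s x
  = (\prod_(i < N) qint (i.+1 * r) (e ^+ i * y) * qint (N.+1 * t) (e ^+ N * y)) *+ s.
Proof.
pose of_pair (v : 'S_N.+1 * {ffun 'I_N.+1 -> 'I_r.-1.+1}) : colored_perm r N.+1 :=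
  ColoredPerm v.2 v.1.
rewrite (reindex of_pair); last first.
  by exists (fun x => (uperm x, colors x)) => [[]|[]].
rewrite -(pair_bigA _ (fun u c =>
  e ^+ inv u * y ^+ fmaj_rep s (ColoredPerm c u : colored_perm r N.+1))) /=.
under eq_bigr => u _ do rewrite -mulr_sumr sum_colors mulrCA [e ^+ _ * (_ * _)]mulrA.
rewrite -mulr_sumr -mulr_suml.
have := signed_mahonian y e2 N.+1; rewrite /signed_maj => ->.
(* [i * i.+1] is even, so the sign disappears and [qintM] can merge [qint i.+1] with the color
   factor of the same index. *)
have eyX i : (e ^+ i * y) ^+ i.+1 = y ^+ i.+1.
  rewrite exprMn -exprM; suff -> : e ^+ (i * i.+1) = 1 by rewrite mul1r.
  elim: i => [|i IHi]; first by rewrite mul0n.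
  rewrite (_ : i.+1 * i.+2 = 2 * i.+1 + i * i.+1)%N; last by lia.
  by rewrite exprD exprM e2 expr1n mul1r.
rewrite mulrnAl; congr (_ *+ s).
under [in RHS]eq_bigr => i _ do rewrite qintM eyX.
rewrite qintM eyX big_ord_recr big_split /=; ring.
Qed.

End TotalSum.

Lemma zeta_expr (R : realType) (r : nat) : (0 < r)%N -> zeta R r ^+ r = 1.
Proof.
move=> r_gt0; pose a : R := 2 * pi / r%:R.
have de_moivre m : zeta R r ^+ m = Complex (cos (a *+ m)) (sin (a *+ m)).
  elim: m => [|m IHm]; first by rewrite mulr0n cos0 sin0.
  rewrite exprS IHm mulrS cosD sinD /zeta -/a; simpc.
  by rewrite [cos a * sin _ + _]addrC.
rewrite de_moivre -[a *+ r]mulr_natr /a divfK ?Num.Theory.pnatr_eq0 -?lt0n //.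
by rewrite mulr_natl cos2pi sin2pi.
Qed.

(** * Discarding the degrees not divisible by [p] *)

Section KeepMult.
Variables (A : comNzRingType) (p : nat).
Implicit Types F G : {poly A}.

Lemma coef_keep_mult F i : (keep_mult p F)`_i = if (p %| i)%N then F`_i else 0.
Proof.
rewrite coef_poly; case: ltnP => // /(nth_default 0) ->.
by case: ifP.
Qed.

Lemma keep_mult_sum (I : finType) (c : I -> A) (f : I -> nat) :
  keep_mult p (\sum_i c i *: 'X^(f i)) = \sum_(i | (p %| f i)%N) c i *: 'X^(f i).
Proof.
apply/polyP => j; rewrite coef_keep_mult !coef_sum.
rewrite [RHS]big_mkcond; case: ifP => pj.
  apply: eq_bigr => i _; rewrite coefZ coefXn; case: eqP => [<-|_]; first by rewrite pj.
  by rewrite mulr0 if_same.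
rewrite big1 // => i _; rewrite coefZ coefXn; case: ifP => // pfi.
by case: eqP => [jE|]; [rewrite jE pfi in pj | rewrite mulr0].
Qed.

(** Polynomials in ['X ^+ p], described by coefficients. *)
Definition mult_supported F := forall i, ~~ (p %| i)%N -> F`_i = 0.

Lemma mult_supportedM F G :
  mult_supported F -> mult_supported G -> mult_supported (F * G).
Proof.
move=> F0 G0 i npi; rewrite coefM big1 // => j _.
have [pj|/F0 ->] := boolP (p %| j)%N; last by rewrite mul0r.
rewrite G0 ?mulr0 //; apply: contra npi => pij.
by rewrite -(subnKC (ltn_ord j : j <= i)%N) dvdn_add.
Qed.

Lemma mult_supported_prod (I : Type) (s : seq I) (F : I -> {poly A}) :
  (forall i, mult_supported (F i)) -> mult_supported (\prod_(i <- s) F i).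
Proof.
move=> F0; elim: s => [|i s IHs]; last by rewrite big_cons; apply: mult_supportedM.
by rewrite big_nil => j; rewrite coef1; case: eqP => // ->; rewrite dvdn0.
Qed.

Lemma mult_supported_qint m a : mult_supported (qint m ((a *: 'X) ^+ p)).
Proof.
move=> i npi; rewrite /qint coef_sum big1 // => j _.
rewrite -exprM exprZn coefZ coefXn; case: eqP => [iE|]; last by rewrite mulr0.
by rewrite iE dvdn_mulr in npi.
Qed.

(** Multiplication by a polynomial in ['X ^+ p] preserves degrees modulo [p], so it commutes with
    the selection. *)
Lemma keep_multM F G : mult_supported F -> keep_mult p (F * G) = F * keep_mult p G.
Proof.
move=> F0; apply/polyP => i; rewrite coef_keep_mult !coefM; case: ifP => pi.
  apply: eq_bigr => j _; rewrite coef_keep_mult.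
  have [pj|/F0 ->] := boolP (p %| j)%N; last by rewrite !mul0r.
  by rewrite dvdn_sub.
rewrite big1 // => j _; rewrite coef_keep_mult; case: ifP => pij; last by rewrite mulr0.
rewrite F0 ?mul0r //; apply/negP => pj.
by rewrite -(subnKC (ltn_ord j : j <= i)%N) dvdn_add in pi.
Qed.

Lemma keep_multMn F m : keep_mult p (F *+ m) = keep_mult p F *+ m.
Proof.
apply/polyP => i; rewrite coefMn !coef_keep_mult coefMn; case: ifP => // _.
by rewrite mul0rn.
Qed.

End KeepMult.

(** The sign [e ^+ i] depends on the parity of [i] only, and [n./2] of the indices below [n] are
    odd. *)
Lemma prod_sign_powers (S A : comNzRingType) (e : S) (f : S -> A) n : e ^+ 2 = 1 ->
  \prod_(i < n) f (e ^+ i) = f 1 ^+ (n - n./2) * f e ^+ n./2.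
Proof.
move=> e2; have eE i : e ^+ i = e ^+ odd i.
  by rewrite -{1}(odd_double_half i) exprD -mul2n exprM e2 expr1n mulr1.
elim: n => [|n IHn]; first by rewrite big_ord0 !expr0 mulr1.
rewrite big_ord_recr IHn /= eE uphalf_half.
have := odd_double_half n; case: (odd n) => /= nE.
  rewrite (_ : n.+1 - (1 + n./2) = n - n./2)%N; last by lia.
  by rewrite expr1 add1n exprSr mulrA.
rewrite (_ : n.+1 - (0 + n./2) = (n - n./2).+1)%N; last by lia.
by rewrite expr0 add0n exprSr mulrAC.
Qed.

(** * Cosets of $C_s$; color sum against flag major index *)

Section Cosets.
Variables (r p s N : nat).
Hypotheses (r_gt0 : (0 < r)%N) (p_dvd_r : (p %| r)%N) (s_gt0 : (0 < s)%N).
Hypotheses (s_dvd_r : (s %| r)%N) (ps_dvd_rn : (p * s %| r * N.+1)%N).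
Local Notation G := (colored_perm r N.+1).
Local Notation t := (r %/ s)%N.
Implicit Types x g : G.

(** The [m]-th power of the generator has all colors [t * m] modulo [r], so it is trivial iff [s]
    divides [m]. *)
Lemma card_Cs : #|Cs r s N.+1| = s.
Proof.
have colors_expr m i : colors (Cs_gen r s N.+1 ^+ m)%g i = inZp (t * m).
  elim: m => [|m IHm].
    by rewrite expg0 ffunE muln0; apply: val_inj; rewrite /= mod0n.
  rewrite expgSr ffunE /= ffunE perm1 IHm; apply: val_inj.
  by rewrite /= modnDm mulnS.
have uperm_expr m : uperm (Cs_gen r s N.+1 ^+ m)%g = 1%g.
  by elim: m => [|m IHm]; rewrite ?expg0 // expgSr /= IHm mulg1.
have expr1P m : (Cs_gen r s N.+1 ^+ m == 1)%g = (s %| m)%N.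
  have t_gt0 : (0 < t)%N by rewrite divn_gt0 // dvdn_leq.
  rewrite -[RHS](@dvdn_pmul2l t s m t_gt0) divnK //.
  apply/eqP/idP => [/(congr1 (fun g => colors g ord_max : nat)) | rtm].
    by rewrite colors_expr ffunE /= prednK // => /eqP.
  have /= := uperm_expr m; have := colors_expr m.
  case: (_ ^+ m)%g => c u /= cE ->; rewrite /oneg /= /colored_perm_one.
  congr ColoredPerm; apply/ffunP => i; rewrite cE ffunE; apply: val_inj.
  by rewrite /= prednK //; apply/eqP.
apply/eqP; rewrite -[#|_|]/(#[Cs_gen r s N.+1])%g eqn_dvd order_dvdn expr1P dvdnn /=.
by rewrite -expr1P expg_order.
Qed.

(** The fibres of the coset map are cosets of [Cs], of [s] elements each, and [F] is constant on
    them. *)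
Lemma sum_over_cosets (A : nmodType) (F : G -> A) :
  (forall x, F (x * Cs_gen r s N.+1)%g = F x) ->
  \sum_(x in Grpn r p N.+1) F x = (\sum_(g in Grpsn r p s N.+1) F (repr g)) *+ s.
Proof.
move=> F_gen.
have F_Cs x y : y \in Cs r s N.+1 -> F (x * y)%g = F x.
  move/cycleP => [m ->]; elim: m => [|m IHm]; first by rewrite expg0 mulg1.
  by rewrite expgSr mulgA F_gen.
have Cs_norm x : x \in 'N(Cs r s N.+1)%g.
  by apply: (subsetP (cent_sub _)); rewrite cent_cycle; apply/cent1P/Cs_gen_central.
have Cs_comm x y : y \in Cs r s N.+1 -> (y * x = x * y)%g.
  move/cycleP => [m ->]; apply/esym/commuteX; exact: Cs_gen_central.
pose Gp := Group (Grpn_group_set N.+1 r_gt0 p_dvd_r).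
have Cs_sub : Cs r s N.+1 \subset Gp by apply: Cs_sub_Grpn.
rewrite (partition_big (coset (Cs r s N.+1)) (mem (Grpsn r p s N.+1))); last first.
  by move=> x xG; apply: mem_morphim (Cs_norm x) xG.
rewrite -sumrMnl; apply: eq_bigr => g /morphimP[x0 _ x0G /= gE].
have inP x : (x \in Grpn r p N.+1) && (coset (Cs r s N.+1) x == g)
    = (x \in Cs r s N.+1 :* x0)%g.
  rewrite gE; apply/andP/idP => [[_ /eqP] | xx0].
    by move/(rcoset_kercosetP (Cs_norm _) (Cs_norm _)).
  split; last exact/eqP/(rcoset_kercosetP (Cs_norm _) (Cs_norm _)).
  have /rcosetP[y yC ->] := xx0.
  exact: (@groupM _ Gp _ _ (subsetP Cs_sub _ yC) x0G).
have F_rcoset x : x \in (Cs r s N.+1 :* x0)%g -> F x = F x0.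
  by case/rcosetP => y yC ->; rewrite Cs_comm // F_Cs.
under eq_bigl => x do rewrite inP.
rewrite (eq_bigr (fun=> F (repr g))) => [|x /F_rcoset ->]; last first.
  by apply/esym/F_rcoset; rewrite -val_coset // -gE mem_repr_coset.
by rewrite sumr_const card_rcoset card_Cs.
Qed.

(** Adding [t] to all colors preserves their differences and, as [t] divides [r], the residue of the
    last one modulo [t]. *)
Lemma fmaj_rep_Cs_gen x : fmaj_rep s (x * Cs_gen r s N.+1)%g = fmaj_rep s x.
Proof.
have t_dvd_r : (t %| r)%N by apply/dvdnP; exists s; rewrite mulnC divnK.
have colorsE i : colors (x * Cs_gen r s N.+1)%g i = inZp t + colors x i.
  by rewrite ffunE /= ffunE perm1.
have diffE (j : 'I_N) :
    color_diff (colors (x * Cs_gen r s N.+1)%g) (widen_ord (leqnSn N) j)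
    = color_diff (colors x) (widen_ord (leqnSn N) j).
  by rewrite !color_diff_widen !colorsE opprD addrACA subrr add0r.
rewrite !fmaj_repE // colorsE /=; congr (_ * _ + _)%N.
  by move: (nat_of_ord _) => c; rewrite prednK // modnDml modn_dvdm // modnDl.
apply: eq_bigr => j _; rewrite /hdes diffE /=.
by rewrite !permM !perm1.
Qed.

(** The differences telescope: $k_i\equiv c_i-c_n+R_t(c_n)$ modulo $r$, with $c_n$ moved to the left
    to avoid subtraction. *)
Lemma kstat_end_color g m : (m <= N)%N ->
  kstat_end s g m + colors g ord_max
  = color_at g (N - m) + colors g ord_max %% t %[mod r].
Proof.
elim: m => [|m IHm] lemN /=.
  by rewrite subn0 (color_atE g ord_max) /residue modz_nat absz_nat addnC.
have color_atI l : (l <= N)%N -> color_at g l = colors g (inord l).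
  by move=> lel; rewrite -color_atE inordK.
rewrite addnAC -modnDml IHm ?(ltnW lemN) // modnDml addnAC.
rewrite -modnDml -[RHS]modnDml; congr ((_ + _) %% _)%N.
rewrite addnC !color_atI ?leq_subr //.
set a := colors g (inord (N - m.+1)); set b := colors g _.
rewrite -{1}(prednK r_gt0) residue_ordB.
have : ((a - b)%R + b)%N = a %[mod r.-1.+1].
  by rewrite -{2}(subrK b a) /= modn_mod.
by move: (nat_of_ord _) (nat_of_ord b) (nat_of_ord a) => i j l; rewrite prednK.
Qed.

(** Summing the congruences for $k_i$ leaves the correction $n(c_n-R_t(c_n))$, and
    $c_n-R_t(c_n)=t\lfloor c_n/t\rfloor$. *)
Lemma color_sum_fmaj g :
  color_sum g = fmaj_rep s g + N.+1 * t * (colors g ord_max %/ t) %[mod r].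
Proof.
set c := colors g ord_max.
apply/eqP; rewrite -(eqn_modDr (N.+1 * (c %% t))) -addnA -mulnA -mulnDr.
rewrite [(t * _)%N]mulnC -divn_eq eq_sym; apply/eqP.
have constE a : (N.+1 * a = \sum_(i < N.+1) a)%N by rewrite sum_nat_const card_ord.
rewrite /fmaj_rep /color_sum !constE -!big_split /=.
rewrite -[LHS]modn_summ -[RHS]modn_summ; congr (_ %% _)%N; apply: eq_bigr => i _.
have lei : (i <= N)%N by rewrite -ltnS.
rewrite /lambda_stat -addnA mulnC modnMDl /kstat kstat_end_color ?leq_subr //=.
by rewrite subKn // color_atE.
Qed.

(** The correction term is a multiple of [N.+1 * t], hence of [p], because [p * s] divides
    [r * N.+1]. *)
Lemma dvdn_color_sum g : (p %| color_sum g)%N = (p %| fmaj_rep s g)%N.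
Proof.
have p_dvd_nt : (p %| N.+1 * t)%N.
  by rewrite -(dvdn_pmul2r s_gt0) -mulnA divnK // mulnC [(N.+1 * _)%N]mulnC mulnC.
rewrite /dvdn -(modn_dvdm _ p_dvd_r) color_sum_fmaj modn_dvdm //.
by rewrite -!/(dvdn _ _) dvdn_addl // dvdn_mulr.
Qed.

(** Multiplied by [k], the correction term becomes a multiple of [r = t * s], since [s] divides
    [k * N.+1]. *)
Lemma expr_color_sum (A : nzRingType) (z : A) k g : z ^+ r = 1 -> (s %| k * N.+1)%N ->
  z ^+ (k * color_sum g) = z ^+ (k * fmaj_rep s g).
Proof.
move=> zr s_dvd_kn; rewrite -(expr_mod _ zr) -[RHS](expr_mod _ zr); congr (_ ^+ _).
have r_dvd : (r %| k * (N.+1 * t * (colors g ord_max %/ t)))%N.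
  rewrite !mulnA dvdn_mulr // -{1}(divnK s_dvd_r) [(t * s)%N]mulnC.
  exact: dvdn_mul.
by rewrite -modnMmr color_sum_fmaj modnMmr mulnDr -modnDmr (eqP r_dvd) addn0.
Qed.

End Cosets.

Theorem theorem4p1 (R : realType) (r p s n : nat)
  (r_gt0 : (0 < r)%N) (p_gt0 : (0 < p)%N) (s_gt0 : (0 < s)%N) (n_gt0 : (0 < n)%N)
  (p_dvd_r : (p %| r)%N) (s_dvd_r : (s %| r)%N) (ps_dvd_rn : (p * s %| r * n)%N)
  (eps : R[i]) (eps_sign : eps = 1 \/ eps = -1)
  (k : nat) (k_lt : (k < r %/ p)%N) (s_dvd_kn : (s %| k * n)%N) :
  let z := zeta R r in
  let m := n./2 in
  \sum_(g in Grpsn r p s n) chi eps k g *: ('X : {poly R[i]}) ^+ fmaj g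
  = (\prod_(1 <= i < n)
       qint (i * r %/ p) (((eps ^+ i.-1 * z ^+ k) *: 'X) ^+ p))
    * qint (n * r %/ (p * s)) (((eps ^+ n.-1 * z ^+ k) *: 'X) ^+ p)
    * keep_mult p (qint p (z ^+ k *: 'X) ^+ (n - m)
                   * qint p ((eps * z ^+ k) *: 'X) ^+ m).
Proof.
case: n n_gt0 ps_dvd_rn s_dvd_kn => // N _ ps_dvd_rn s_dvd_kn z m.
have eps2 : eps ^+ 2 = 1 by case: eps_sign => ->; rewrite ?sqrrN expr1n.
have s_neq0 : s%:R != 0 :> R[i] by rewrite Num.Theory.pnatr_eq0 -lt0n.
pose x := z ^+ k *: 'X : {poly R[i]}; pose e := eps%:P.
have e2 : e ^+ 2 = 1 by rewrite -rmorphXn eps2.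
have exE i : e ^+ i * x = (eps ^+ i * z ^+ k) *: 'X.
  by rewrite -rmorphXn mul_polyC scalerA.
pose F (g : colored_perm r N.+1) : {poly R[i]} := e ^+ inv (uperm g) * x ^+ fmaj_rep s g.
have FE g : F g = (eps ^+ inv (uperm g) * z ^+ (k * fmaj_rep s g)) *: 'X^(fmaj_rep s g).
  by rewrite /F exprZn -rmorphXn mul_polyC scalerA exprM.
(* Both sides are multiplied by [s], so that the sum over cosets becomes a sum over group
   elements. *)
apply: (scalerI s_neq0); rewrite !scaler_nat.
transitivity ((\sum_(g in Grpsn r p s N.+1) F (repr g)) *+ s).
  congr (_ *+ s); apply: eq_bigr => g _.
  by rewrite FE /chi perm_inv_countE (expr_color_sum (s := s)) // zeta_expr.
rewrite -sum_over_cosets //; last first.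
  by move=> g; rewrite /F fmaj_rep_Cs_gen //= mul1g.
(* [F g] is a multiple of the monomial of degree [fmaj_rep s g], which [p] divides exactly when [g]
   is in [Grpn]. *)
transitivity (keep_mult p (\sum_g F g)).
  under [in RHS]eq_bigr => g _ do rewrite FE.
  rewrite keep_mult_sum; apply: eq_big => [g|g _]; last by rewrite FE.
  by rewrite inE (dvdn_color_sum (s := s)).
rewrite (sum_signed_fmaj _ e2) // keep_multMn; congr (_ *+ s).
(* The factors outside the braces are polynomials in ['X ^+ p], so they may be moved under
   [keep_mult]. *)
rewrite -keep_multM; last first.
  by apply: mult_supportedM; [apply: mult_supported_prod => i|];
    apply: mult_supported_qint.
congr (keep_mult p _).
have <- : \prod_(i < N.+1) qint p (e ^+ i * x)
    = qint p (z ^+ k *: 'X) ^+ (N.+1 - m) * qint p ((eps * z ^+ k) *: 'X) ^+ m.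
  rewrite (prod_sign_powers (fun a => qint p (a * x))) // mul1r.
  by have := exE 1; rewrite !expr1 => ->.
rewrite big_add1 big_mkord /= big_ord_recr /= mulrACA -big_split /=.
congr (_ * _).
  apply: eq_bigr => i _; rewrite -exE [RHS]mulrC -qintM; congr qint.
  by rewrite [RHS]mulnC divnK // dvdn_mull.
rewrite -exE [RHS]mulrC -qintM; congr qint.
(* After multiplication by [s], both sides equal [N.+1 * r]. *)
apply/eqP; rewrite -(eqn_pmul2r s_gt0) -mulnA divnK //; apply/eqP.
by rewrite mulnAC [RHS]mulnC divnK // [(_ * r)%N]mulnC.
Qed.
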